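(* Let $n\ge1$, let $X$ be a finite birack, $A$ an abelian group and $\phi:X\times X\to A$ a birack 2-cocycle. Both polynomials $\Phi_X^{\mathcal{BCQ},\phi}$ and $\Phi_X^{\phi,2}$ are invariants of braids; that is, if $B$ and $B'$ are $n$-strand braid diagrams related by a finite sequence of braid Reidemeister moves, then $\Phi_X^{\mathcal{BCQ},\phi}(B)=\Phi_X^{\mathcal{BCQ},\phi}(B')$ and $\Phi_X^{\phi,2}(B)=\Phi_X^{\phi,2}(B')$.
   Context: A birack is a set $X$ with binary operations $\underline{\triangleright},\overline{\triangleright}:X\times X\to X$ such that: (i) for all $y\in X$ the maps $\alpha_y(x)=x\mathbin{\overline{\triangleright}}y$ and $\beta_y(x)=x\mathbin{\underline{\triangleright}}y$ are bijections of $X$; (ii) the map $S(x,y)=(y\mathbin{\overline{\triangleright}}x,\;x\mathbin{\underline{\triangleright}}y)$ is a bijection of $X\times X$; (iii) for all $x,y,z\in X$: $(x\mathbin{\underline{\triangleright}}y)\mathbin{\underline{\triangleright}}(z\mathbin{\underline{\triangleright}}y)=(x\mathbin{\underline{\triangleright}}z)\mathbin{\underline{\triangleright}}(y\mathbin{\overline{\triangleright}}z)$, $(x\mathbin{\underline{\triangleright}}y)\mathbin{\overline{\triangleright}}(z\mathbin{\underline{\triangleright}}y)=(x\mathbin{\overline{\triangleright}}z)\mathbin{\underline{\triangleright}}(y\mathbin{\overline{\triangleright}}z)$, $(x\mathbin{\overline{\triangleright}}y)\mathbin{\overline{\triangleright}}(z\mathbin{\overline{\triangleright}}y)=(x\mathbin{\overline{\triangleright}}z)\mathbin{\overline{\triangleright}}(y\mathbin{\underline{\triangleright}}z)$.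 A birack determines a bijection $\rho:X\times X\to X\times X$, $\rho(x,y)=(\alpha_x^{-1}(y),\;x\mathbin{\underline{\triangleright}}\alpha_x^{-1}(y))$, which satisfies the set-theoretic Yang-Baxter equation (so $(X,\rho)$ is a switch); equivalently $\rho(x,\,y\mathbin{\overline{\triangleright}}x)=(y,\,x\mathbin{\underline{\triangleright}}y)$. The birack boundary maps $\partial_k:A[X^k]\to A[X^{k-1}]$ are given by $\partial_k(x_1,\dots,x_k)=\sum_{j=1}^k(-1)^j[(x_1,\dots,x_{j-1},x_{j+1},\dots,x_k)-(x_1\mathbin{\underline{\triangleright}}x_j,\dots,x_{j-1}\mathbin{\underline{\triangleright}}x_j,x_{j+1}\mathbin{\overline{\triangleright}}x_j,\dots,x_k\mathbin{\overline{\triangleright}}x_j)]$. A birack 2-cocycle is a function $\phi:X\times X\to A$ whose coboundary (dual to $\partial_3$) vanishes, i.e. for all $x,y,z\in X$: $\phi(y,z)+\phi(x\mathbin{\underline{\triangleright}}y,\,z\mathbin{\overline{\triangleright}}y)+\phi(x,y)=\phi(y\mathbin{\overline{\triangleright}}x,\,z\mathbin{\overline{\triangleright}}x)+\phi(x,z)+\phi(x\mathbin{\underline{\triangleright}}z,\,y\mathbin{\underline{\triangleright}}z)$. An $n$-strand braid diagram $B$ is (up to planar isotopy) a word in $\sigma_1^{\pm1},\dots,\sigma_{n-1}^{\pm1}$ read from top to bottom, where $\sigma_i$ denotes a positive crossing of the strands in positions $i,i+1$; planar isotopy allows $\sigma_i^{\pm1}\sigma_j^{\pm1}=\sigma_j^{\pm1}\sigma_i^{\pm1}$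 (any signs) for $|i-j|\ge2$. The braid Reidemeister moves are the direct Reidemeister II moves (inserting or deleting $\sigma_i\sigma_i^{-1}$ or $\sigma_i^{-1}\sigma_i$) and the Reidemeister III moves ($\sigma_i\sigma_{i+1}\sigma_i\leftrightarrow\sigma_{i+1}\sigma_i\sigma_{i+1}$ and its variants with other crossing signs). A vector $v\in X^n$ of colors at the top of $B$ determines a coloring of all semiarcs of $B$ by propagating downwards: at $\sigma_i$ the colors $(p,q)$ in positions $i,i+1$ above the crossing become $\rho(p,q)$ below it, and at $\sigma_i^{-1}$ they become $\rho^{-1}(p,q)$. The resulting bottom vector is $\varphi_B(v)$. The switch braid quiver $\mathcal{SQ}_X(B)$ has vertex set $X^n$ and a directed edge from $\overline{x}$ to $\overline{y}$ if and only if $\varphi_B(\overline{x})=\overline{y}$. Since $\varphi_B$ is a bijection of the finite set $X^n$, this quiver is a disjoint union of directed cycles; $\mathcal{L}(v)$ denotes the length of the directed cycle containing $v$ (a loop has length $1$). For a crossing $c$ of $B$ colored in this way, let $(x(c),y(c))$ be the pair of colors on the left of the crossing (i.e. in position $i$): $x(c)$ is the top-left and $y(c)$ the bottom-left color at a positive crossing, and $x(c)$ is the bottom-left and $y(c)$ the top-left color at a negative crossing. The Boltzmann weight of $v$ is $BW(v)=\sum_{c}\pm\phi(x(c),y(c))\in A$, with sign $+$ at positive crossings and $-$ at negative crossings. The birack braid cocycle quiver $\mathcal{BCQ}_X^{\phi}(B)$ is $\mathcal{SQ}_X(B)$ with each vertex $v$ given the weight $BW(v)$. The birack braid cocycle quiver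 polynomial is $\Phi_X^{\mathcal{BCQ},\phi}(B)=\sum_{w}u^{\mathcal{L}(w)}v^{BW(w)}$, the sum being over all vertices $w$ of $\mathcal{BCQ}_X^{\phi}(B)$ (here $u,v$ are formal variables). The birack braid cocycle 2-variable polynomial is $\Phi_X^{\phi,2}(B)=\sum_{e}s^{BW(s(e))}t^{BW(t(e))}$, the sum being over all edges $e$ of $\mathcal{BCQ}_X^{\phi}(B)$, where $s(e)$ and $t(e)$ in the exponents are the source and target vertices of $e$ and $s,t$ are formal variables. Exponents of $v,s,t$ are elements of $A$, so these are formal sums (elements of $\mathbb{Z}[u]$ tensored with the group ring $\mathbb{Z}[A]$, respectively of the group ring $\mathbb{Z}[A\times A]$). *)

(* Defs.v *)
From Stdlib Require Export Relation_Operators.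
From mathcomp Require Export all_boot all_order all_algebra.
From mathcomp Require Export monalg.

Set Implicit Arguments.
Unset Strict Implicit.
Unset Printing Implicit Defensive.

Import GRing.Theory.
Local Open Scope ring_scope.

Record birack (X : Type) := Birack {
  under : X -> X -> X;
  over : X -> X -> X;
  over_bij : forall y, bijective (fun x => over x y);
  under_bij : forall y, bijective (fun x => under x y);
  sideways_bij :
    bijective (fun p : X * X => (over p.2 p.1, under p.1 p.2));
  exchange_under : forall x y z,
    under (under x y) (under z y) = under (under x z) (over y z);
  exchange_mixed : forall x y z,
    over (under x y) (under z y) = under (over x z) (over y z);
  exchange_over : forall x y z,
    over (over x y) (over z y) = over (over x z) (under y z)
}.

Definition birack_2cocycle (X : Type) (b : birack X) (A : zmodType)
    (phi : X -> X -> A) : Prop :=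
  forall x y z : X,
    phi y z + phi (under b x y) (over b z y) + phi x y
    = phi (over b y x) (over b z x) + phi x z
      + phi (under b x z) (under b y z).

(* The pair (i, true) is the positive crossing of the strands in positions
   i and i + 1, the pair (i, false) the negative one. Positions are numbered
   from 0, so i ranges over {0, ..., n - 2}. *)
Definition crossing (n : nat) : Type := ('I_n.-1 * bool)%type.

(* Words are read from top to bottom. They represent braid diagrams before
   quotienting by planar isotopy, which is part of [braid_step] below. *)
Definition braid_word (n : nat) : Type := seq (crossing n).

Inductive braid_step (n : nat) : braid_word n -> braid_word n -> Prop :=
| planar_isotopy (B1 B2 : braid_word n) (i j : 'I_n.-1) (e f : bool) :
    (i.+1 < j)%N || (j.+1 < i)%N ->
    braid_step (B1 ++ [:: (i, e); (j, f)] ++ B2)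
               (B1 ++ [:: (j, f); (i, e)] ++ B2)
| reidemeister2 (B1 B2 : braid_word n) (i : 'I_n.-1) (e : bool) :
    braid_step (B1 ++ B2) (B1 ++ [:: (i, e); (i, ~~ e)] ++ B2)
(* The sign condition discards exactly the patterns + - + and - + -, for which
   no strand passes entirely over or under the other two. *)
| reidemeister3 (B1 B2 : braid_word n) (i j : 'I_n.-1) (e f g : bool) :
    j = i.+1 :> nat -> (e == f) || (f == g) ->
    braid_step (B1 ++ [:: (i, e); (j, f); (i, g)] ++ B2)
               (B1 ++ [:: (j, g); (i, f); (j, e)] ++ B2).

Definition braid_equiv (n : nat) : braid_word n -> braid_word n -> Prop :=
  clos_refl_sym_trans (braid_word n) (@braid_step n).

Lemma strand_right_subproof (n : nat) (i : 'I_n.-1) : (i.+1 < n)%N.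
Proof. by case: n i => [|n] [i /=]. Qed.

Definition strand_left (n : nat) (i : 'I_n.-1) : 'I_n :=
  widen_ord (leq_pred n) i.

Definition strand_right (n : nat) (i : 'I_n.-1) : 'I_n :=
  Ordinal (strand_right_subproof i).

Section Colorings.
Variables (X : finType) (b : birack X).

(* [finv f] is the inverse of an injective map f of a finite type to itself. *)
Definition alpha_inv (y : X) : X -> X := finv (fun x => over b x y).

Definition rho (p : X * X) : X * X :=
  (alpha_inv p.1 p.2, under b p.1 (alpha_inv p.1 p.2)).

Variable n : nat.

Definition cross_map (e : bool) : X * X -> X * X :=
  if e then rho else finv rho.

Definition color_step (c : crossing n) (v : {ffun 'I_n -> X}) :
    {ffun 'I_n -> X} :=
  let l := strand_left c.1 in
  let r := strand_right c.1 in
  let q := cross_map c.2 (v l, v r) in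
  [ffun k => if k == l then q.1 else if k == r then q.2 else v k].

Fixpoint braid_map (B : braid_word n) (v : {ffun 'I_n -> X}) :
    {ffun 'I_n -> X} :=
  if B is c :: B' then braid_map B' (color_step c v) else v.

Definition switch_quiver (B : braid_word n) : rel {ffun 'I_n -> X} :=
  fun x y => braid_map B x == y.

Definition quiver_edges (B : braid_word n) :
    {set {ffun 'I_n -> X} * {ffun 'I_n -> X}} :=
  [set e | switch_quiver B e.1 e.2].

(* [order f v] is the size of the orbit of v under f; as [braid_map B] is a
   bijection, this is the length of the directed cycle of the quiver
   through v. *)
Definition cycle_length (B : braid_word n) (v : {ffun 'I_n -> X}) : nat :=
  order (braid_map B) v.

Variables (A : zmodType) (phi : X -> X -> A).

Definition crossing_weight (c : crossing n) (v : {ffun 'I_n -> X}) : A :=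
  let l := strand_left c.1 in
  let top := v l in
  let bottom := color_step c v l in
  if c.2 then phi top bottom else - phi bottom top.

Fixpoint boltzmann_weight (B : braid_word n) (v : {ffun 'I_n -> X}) : A :=
  if B is c :: B' then
    crossing_weight c v + boltzmann_weight B' (color_step c v)
  else 0.

(* [{malg R[K]}] is the free R-module on K, with [<< c *g k >>] standing for
   the generator k with coefficient c. A formal power v^a is the generator a
   and s^a t^a' is the generator (a, a'); the variable u is ['X]. *)
Definition cocycle_quiver_poly (B : braid_word n) : {malg {poly int}[A]} :=
  \sum_(w : {ffun 'I_n -> X})
    << 'X^(cycle_length B w) *g boltzmann_weight B w >>.

Definition cocycle_2var_poly (B : braid_word n) : {malg int[(A * A)%type]} :=
  \sum_(e in quiver_edges B)
    << 1 *g (boltzmann_weight B e.1, boltzmann_weight B e.2) >>.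

End Colorings.

(* Main.v *)
Require Import Defs.
From mathcomp Require Import zify.

(** Both polynomials depend on a braid word only through the map it induces on
    colorings and through its Boltzmann weight, so it suffices that every move
    preserves these two functions of the top coloring. Call two words that
    agree on both [cocycle_equiv]; this is a congruence for concatenation,
    because weights add along a coloring as it propagates downwards
    ([braid_map_cat], [boltzmann_weight_cat]).

    - A planar isotopy exchanges two crossings that read and write disjoint
      pairs of strands ([cocycle_equiv_planar]).
    - In a Reidemeister II move the second crossing undoes the recoloring made
      by the first, and reads the same pair of left colors with the opposite
      sign ([cocycle_equiv_cancel]).
    - For the all-positive Reidemeister III move, write the top colors as
      [x], [over y x] and [over (over z x) (over y x)]. The three exchange laws
      say that the two sides have equal bottom colors, and the difference of
      their weights is the cocycle condition at [x], [y], [z]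
      ([cocycle_equiv_R3_positive]).
    - The other Reidemeister III moves are formal consequences: cancelling the
      first letter of one side and the last letter of the other turns one sign
      pattern into another, and the two ways of doing so connect the six
      admissible patterns in a hexagon ([cocycle_equiv_R3]). *)

Set Implicit Arguments.
Unset Strict Implicit.
Unset Printing Implicit Defensive.

Import GRing.Theory.
Local Open Scope ring_scope.

(** * The switch map of a birack *)

Section SwitchMap.
Variables (X : finType) (b : birack X).

Lemma overK (x : X) : cancel (fun y => over b y x) (alpha_inv b x).
Proof. exact/finv_f/bij_inj/over_bij. Qed.

Lemma alpha_invK (x : X) : cancel (alpha_inv b x) (fun y => over b y x).
Proof. exact/f_finv/bij_inj/over_bij. Qed.

Lemma rho_over (x y : X) : rho b (x, over b y x) = (y, under b x y).
Proof. by rewrite /rho /= overK. Qed.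

(** Every pair has the form [(x, over y x)], and its image [(y, under x y)]
    determines [y] and then [x], as right translations are injective. *)
Lemma rho_inj : injective (rho b).
Proof.
move=> [x p] [x' p']; rewrite -(alpha_invK x p) -(alpha_invK x' p') !rho_over.
by case=> -> /(bij_inj (under_bij b _)) ->.
Qed.

Lemma cross_mapK (e : bool) : cancel (cross_map b e) (cross_map b (~~ e)).
Proof. by case: e; [apply: finv_f | apply: f_finv]; apply: rho_inj. Qed.

End SwitchMap.

(** * Adjacent strands *)

Section Strands.
Variable n : nat.
Implicit Types i j : 'I_n.-1.

Lemma strand_right_neq_left i : (strand_right i == strand_left i) = false.
Proof. by rewrite -val_eqE /= gtn_eqF. Qed.

Lemma strand_left_next i j : j = i.+1 :> nat -> strand_left j = strand_right i.
Proof. by move=> ji; apply: val_inj. Qed.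

End Strands.

(** * Colorings and weights under the braid moves *)

Section WeightedColorings.
Variables (X : finType) (b : birack X) (n : nat).
Variables (A : zmodType) (phi : X -> X -> A).
Implicit Types (v w : {ffun 'I_n -> X}) (c : crossing n) (B : braid_word n).

Lemma color_step_left c v :
  color_step b c v (strand_left c.1)
  = (cross_map b c.2 (v (strand_left c.1), v (strand_right c.1))).1.
Proof. by rewrite ffunE eqxx. Qed.

Lemma color_step_right c v :
  color_step b c v (strand_right c.1)
  = (cross_map b c.2 (v (strand_left c.1), v (strand_right c.1))).2.
Proof. by rewrite ffunE strand_right_neq_left eqxx. Qed.

Lemma color_step_other c v k :
  k != strand_left c.1 -> k != strand_right c.1 -> color_step b c v k = v k.
Proof. by rewrite ffunE => /negbTE-> /negbTE->. Qed.

Lemma braid_map_cat B1 B2 v :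
  braid_map b (B1 ++ B2) v = braid_map b B2 (braid_map b B1 v).
Proof. by elim: B1 v => //= c B1 IH v. Qed.

Lemma boltzmann_weight_cat B1 B2 v :
  boltzmann_weight b phi (B1 ++ B2) v
  = boltzmann_weight b phi B1 v
    + boltzmann_weight b phi B2 (braid_map b B1 v).
Proof. by elim: B1 v => [|c B1 IH] v /=; rewrite ?add0r // IH addrA. Qed.

Definition cocycle_equiv B B' : Prop :=
  forall v, braid_map b B v = braid_map b B' v
    /\ boltzmann_weight b phi B v = boltzmann_weight b phi B' v.

Lemma cocycle_equiv_refl B : cocycle_equiv B B.
Proof. by []. Qed.

Lemma cocycle_equiv_sym B B' : cocycle_equiv B B' -> cocycle_equiv B' B.
Proof. by move=> BB' v; have [-> ->] := BB' v. Qed.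

Lemma cocycle_equiv_trans B1 B2 B3 :
  cocycle_equiv B1 B2 -> cocycle_equiv B2 B3 -> cocycle_equiv B1 B3.
Proof. by move=> B12 B23 v; have [-> ->] := B12 v. Qed.

Lemma cocycle_equiv_cat B1 B1' B2 B2' :
  cocycle_equiv B1 B1' -> cocycle_equiv B2 B2' ->
  cocycle_equiv (B1 ++ B2) (B1' ++ B2').
Proof.
move=> B11' B22' v; have [m1 w1] := B11' v.
rewrite !braid_map_cat !boltzmann_weight_cat m1 w1.
by have [-> ->] := B22' (braid_map b B1' v).
Qed.

(** The second crossing recovers the top coloring, so its top-left and
    bottom-left colors are those of the first crossing exchanged. This is why
    the weight of a negative crossing swaps the arguments of [phi]. *)
Lemma cocycle_equiv_cancel (i : 'I_n.-1) (e : bool) :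
  cocycle_equiv [:: (i, e); (i, ~~ e)] [::].
Proof.
move=> v /=; set w := color_step b (i, e) v.
have wE : (w (strand_left i), w (strand_right i))
        = cross_map b e (v (strand_left i), v (strand_right i)).
  rewrite /w (color_step_left (i, e)) (color_step_right (i, e)).
  by rewrite -surjective_pairing.
have wK : color_step b (i, ~~ e) w = v.
  apply/ffunP => k; rewrite ffunE /= wE cross_mapK /=.
  case: eqVneq => [-> //|kl]; case: eqVneq => [-> //|kr].
  exact: color_step_other.
split=> //; rewrite /crossing_weight /= wK -/w addr0.
by case: e {wE wK} @w => /=; rewrite ?subrr ?addNr.
Qed.

Lemma crossing_weight_local c v w :
  v (strand_left c.1) = w (strand_left c.1) ->
  v (strand_right c.1) = w (strand_right c.1) ->
  crossing_weight b phi c v = crossing_weight b phi c w.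
Proof. by rewrite /crossing_weight !color_step_left => -> ->. Qed.

Lemma cocycle_equiv_planar (i j : 'I_n.-1) (e f : bool) :
  (i.+1 < j)%N || (j.+1 < i)%N ->
  cocycle_equiv [:: (i, e); (j, f)] [:: (j, f); (i, e)].
Proof.
move=> far v.
have [ll lr rl rr] : [/\ strand_left i != strand_left j,
    strand_left i != strand_right j, strand_right i != strand_left j
    & strand_right i != strand_right j].
  by rewrite -!val_eqE /=; split; lia.
have il : color_step b (i, e) v (strand_left j) = v (strand_left j).
  by apply: color_step_other; rewrite eq_sym.
have ir : color_step b (i, e) v (strand_right j) = v (strand_right j).
  by apply: color_step_other; rewrite eq_sym.
have jl : color_step b (j, f) v (strand_left i) = v (strand_left i).
  exact: color_step_other.
have jr : color_step b (j, f) v (strand_right i) = v (strand_right i).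
  exact: color_step_other.
split=> /=; last first.
  rewrite !addr0 addrC (@crossing_weight_local (j, f) _ v il ir).
  by rewrite (@crossing_weight_local (i, e) _ v jl jr).
apply/ffunP => k; rewrite [LHS]ffunE [RHS]ffunE /= il ir jl jr !ffunE /=.
have [->|_] := eqVneq k (strand_left i).
  by rewrite (negbTE ll) (negbTE lr).
have [->|//] := eqVneq k (strand_right i).
by rewrite (negbTE rl) (negbTE rr).
Qed.

(** Cancelling the first letter on the left and the last letter on the right
    moves both, inverted, to the opposite ends and sides. *)
Lemma cocycle_equiv_move_letters (i j : 'I_n.-1) (e f : bool) W W' :
  cocycle_equiv ((i, e) :: W) (W' ++ [:: (j, f)]) ->
  cocycle_equiv (W ++ [:: (j, ~~ f)]) ((i, ~~ e) :: W').
Proof.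
move=> WW'.
have left_cancel :
    cocycle_equiv ([:: (i, ~~ e); (i, e)] ++ W ++ [:: (j, ~~ f)])
                  (W ++ [:: (j, ~~ f)]).
  rewrite -{2}(negbK e); apply: (@cocycle_equiv_cat _ [::]) => //.
  exact: cocycle_equiv_cancel.
have right_cancel :
    cocycle_equiv (((i, ~~ e) :: W') ++ [:: (j, f); (j, ~~ f)])
                  ((i, ~~ e) :: W').
  rewrite -[X in cocycle_equiv _ X]cats0; apply: cocycle_equiv_cat => //.
  exact: cocycle_equiv_cancel.
apply: cocycle_equiv_trans (cocycle_equiv_sym left_cancel) _.
apply: cocycle_equiv_trans right_cancel.
apply: (@cocycle_equiv_cat [:: (i, ~~ e)] [:: (i, ~~ e)]) => //.
have := cocycle_equiv_cat WW' (@cocycle_equiv_refl [:: (j, ~~ f)]).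
by rewrite -catA.
Qed.

Hypothesis hphi : birack_2cocycle b phi.

(** In the coordinates [(x, over y x)] a positive crossing acts without the
    inverse [alpha_inv], and its left colors are the arguments of the weight. *)
Lemma positive_crossing_over (i : 'I_n.-1) v x y :
  v (strand_left i) = x -> v (strand_right i) = over b y x ->
  let w := color_step b (i, true) v in
  [/\ w (strand_left i) = y, w (strand_right i) = under b x y
    & crossing_weight b phi (i, true) v = phi x y].
Proof.
move=> vl vr w; rewrite /w /crossing_weight.
have rhoE : cross_map b true (v (strand_left i), v (strand_right i))
    = (y, under b x y) by rewrite vl vr; exact: rho_over.
by rewrite (color_step_left (i, true)) (color_step_right (i, true)) rhoE vl.
Qed.

(** The top colors are parametrized so that, on the side that starts with the
    two left strands, the leftmost color is [x], then [y], then [z]. Each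
    exchange law then does one thing: [exchange_over] and [exchange_mixed] put
    a pair into the form [(p, over q p)] before a crossing of the two right
    strands, and [exchange_under] compares the colors at the bottom right. *)
Lemma cocycle_equiv_R3_positive (i j : 'I_n.-1) :
  j = i.+1 :> nat ->
  cocycle_equiv [:: (i, true); (j, true); (i, true)]
                [:: (j, true); (i, true); (j, true)].
Proof.
move=> ji v.
set l := strand_left i; set m := strand_right i; set r := strand_right j.
have jm : strand_left j = m := strand_left_next ji.
have [lm lr mr] : [/\ l != m, l != r & m != r].
  by rewrite -!val_eqE /=; split; lia.
pose x := v l; pose y := alpha_inv b x (v m).
pose z := alpha_inv b x (alpha_inv b (v m) (v r)).
have vm : v m = over b y x by rewrite alpha_invK.
have vr : v r = over b (over b z x) (over b y x).
  by rewrite -vm !alpha_invK.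
have stepi u k : k != l -> k != m -> color_step b (i, true) u k = u k.
  by move=> kl km; apply: color_step_other.
have stepj u k : k != m -> k != r -> color_step b (j, true) u k = u k.
  by rewrite -jm => km kr; apply: color_step_other.
rewrite /=.
(* The side that starts with the crossing of the two left strands. *)
have [al am ->] := positive_crossing_over (erefl x : v l = x) vm.
set va := color_step b (i, true) v in al am *.
have ar : va r = over b (over b z y) (under b x y).
  by rewrite stepi 1?eq_sym // vr exchange_over.
rewrite -/m -jm in am.
have [bm br ->] := positive_crossing_over am ar.
set vb := color_step b (j, true) va in bm br *.
have bl : vb l = y by rewrite stepj.
rewrite jm in bm.
have [cl cm ->] := positive_crossing_over bl bm.
set vc := color_step b (i, true) vb in cl cm *.
(* The side that starts with the crossing of the two right strands. *)
have dm0 : v (strand_left j) = over b y x by rewrite jm.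
have [dm dr ->] := positive_crossing_over dm0 vr.
set vd := color_step b (j, true) v in dm dr *.
have dl : vd l = x by rewrite stepj.
rewrite jm in dm.
have [el em ->] := positive_crossing_over dl dm.
set ve := color_step b (i, true) vd in el em *.
have er : ve r = over b (under b y z) (under b x z).
  by rewrite stepi 1?eq_sym // dr exchange_mixed.
rewrite -/m -jm in em.
have [fm fr ->] := positive_crossing_over em er.
set vf := color_step b (j, true) ve in fm fr *.
rewrite jm in fm.
split; last first.
  by rewrite !addr0 [RHS]addrA -hphi [LHS]addrC [X in X + _ = _]addrC.
apply/ffunP => k.
have [->|kl] := eqVneq k l; first by rewrite cl stepj.
have [->|km] := eqVneq k m; first by rewrite cm fm.
have [->|kr] := eqVneq k r.
  by rewrite stepi 1?eq_sym // br fr exchange_under.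
by rewrite stepi // stepj // stepi // stepj // stepi // stepj.
Qed.

Definition R3_pattern (i j : 'I_n.-1) (e f g : bool) : Prop :=
  cocycle_equiv [:: (i, e); (j, f); (i, g)] [:: (j, g); (i, f); (j, e)].

Lemma R3_pattern_flip_first i j e f g :
  R3_pattern i j e f g -> R3_pattern i j (~~ e) g f.
Proof.
move=> R3; apply: cocycle_equiv_sym.
exact: (@cocycle_equiv_move_letters i j e e [:: (j, f); (i, g)]
                                            [:: (j, g); (i, f)]).
Qed.

Lemma R3_pattern_flip_last i j e f g :
  R3_pattern i j e f g -> R3_pattern i j f e (~~ g).
Proof.
move=> /cocycle_equiv_sym R3.
exact: (@cocycle_equiv_move_letters j i g g [:: (i, f); (j, e)]
                                            [:: (i, e); (j, f)]).
Qed.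

(** Applied alternately from [+ + +], the two flips run through [- + +],
    [+ - -], [- - -], [- - +] and [+ + -], which are all the patterns that the
    sign condition admits. *)
Lemma cocycle_equiv_R3 (i j : 'I_n.-1) (e f g : bool) :
  j = i.+1 :> nat -> (e == f) || (f == g) -> R3_pattern i j e f g.
Proof.
move=> ji.
have ppp : R3_pattern i j true true true by apply: cocycle_equiv_R3_positive.
have mpp := R3_pattern_flip_first ppp.
have pmm := R3_pattern_flip_last mpp.
have mmm := R3_pattern_flip_first pmm.
have mmp := R3_pattern_flip_last mmm.
have ppm := R3_pattern_flip_first mmp.
by case: e; case: f; case: g.
Qed.

Lemma braid_step_cocycle_equiv B B' : braid_step B B' -> cocycle_equiv B B'.
Proof.
by case=> [B1 B2 i j e f far | B1 B2 i e | B1 B2 i j e f g ji efg];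
  apply: cocycle_equiv_cat => //;
  [ apply: (@cocycle_equiv_cat _ _ B2 B2) => //; exact: cocycle_equiv_planar
  | apply/cocycle_equiv_sym/(@cocycle_equiv_cat _ [::] B2 B2) => //;
    exact: cocycle_equiv_cancel
  | apply: (@cocycle_equiv_cat _ [:: _; _; _] B2 B2) => //;
    exact: cocycle_equiv_R3 ].
Qed.

Lemma braid_equiv_cocycle_equiv B B' : braid_equiv B B' -> cocycle_equiv B B'.
Proof.
elim=> {B B'} [B B' | B | B B' _ | B1 B2 B3 _ B12 _].
- exact: braid_step_cocycle_equiv.
- exact: cocycle_equiv_refl.
- exact: cocycle_equiv_sym.
- exact: cocycle_equiv_trans.
Qed.

Lemma cycle_length_cocycle_equiv B B' v :
  cocycle_equiv B B' -> cycle_length b B v = cycle_length b B' v.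
Proof.
move=> BB'; apply: eq_card => w; apply: eq_fconnect => {}w.
by have [] := BB' w.
Qed.

Lemma quiver_edges_cocycle_equiv B B' :
  cocycle_equiv B B' -> quiver_edges b B = quiver_edges b B'.
Proof.
by move=> BB'; apply/setP=> -[v w]; rewrite !inE /switch_quiver (BB' v).1.
Qed.

End WeightedColorings.

Theorem corollary15 (n : nat) (hn : (0 < n)%N) (X : finType) (b : birack X)
    (A : zmodType) (phi : X -> X -> A) (hphi : birack_2cocycle b phi)
    (B B' : braid_word n) (hB : braid_equiv B B') :
  cocycle_quiver_poly b phi B = cocycle_quiver_poly b phi B' /\
  cocycle_2var_poly b phi B = cocycle_2var_poly b phi B'.
Proof.
have BB' := braid_equiv_cocycle_equiv hphi hB.
have weightE v : boltzmann_weight b phi B v = boltzmann_weight b phi B' v.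
  by have [] := BB' v.
split.
  apply: eq_bigr => w _.
  by rewrite (cycle_length_cocycle_equiv w BB') weightE.
rewrite /cocycle_2var_poly (quiver_edges_cocycle_equiv BB').
by apply: eq_bigr => -[v w] _; rewrite /= !weightE.
Qed.
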